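(* Let $m\ge2$, let $p_1,\dots,p_m\in\Delta^n$ be probability vectors, let $C\in\mathbb{R}_+^{n\times\cdots\times n}$ be a cost tensor of order $m$, and let $\varepsilon>0$ be the accuracy. The computational complexity of finding an $\varepsilon$-approximate solution of the non-regularized multimarginal optimal transport problem $$\min\left\{\langle C,X\rangle:\ X\in\mathbb{R}_+^{n\times\cdots\times n},\ p_k(X)=p_k,\ k=1,\dots,m\right\}$$ using the algorithm ''Approximate MOT by PD-AAM'' (described in full in the context) is $$\widetilde O\left(\frac{m^3n^{m+1/2}\|C\|_\infty}{\varepsilon}\right)$$ arithmetic operations.
   Context: $\Delta^n=\{u\in\mathbb{R}^n_+:\sum_ju_j=1\}$. For a tensor $A$ of order $m$, $p_k(A)\in\mathbb{R}^n$ is its $k$-th marginal, $[p_k(A)]_j=\sum_{i_l,\ l\ne k}A_{i_1,\dots,i_{k-1},j,i_{k+1},\dots,i_m}$, while a bare $p_k$ is a given vector; $\langle A,B\rangle$ is the sum of entrywise products; $\|C\|_\infty$ is the maximum entry in absolute value; $\|\cdot\|_1$ is the sum of absolute values of entries; $\log$ and $\ln$ of tensors and vectors are entrywise; $\mathbf 1$ is the all-ones vector in $\mathbb{R}^n$. An $\varepsilon$-approximate solution is a tensor $\widehat X\in\mathbb{R}_+^{n\times\cdots\times n}$ with $p_k(\widehat X)=p_k$ for all $k=1,\dots,m$ and $\langle C,\widehat X\rangle\le\langle C,X^*\rangle+\varepsilon$, where $X^*$ is an optimal solution of the problem. Algorithm ''Approximate MOT by PD-AAM''. Input: accuracy $\varepsilon$.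 1. Set $\gamma=\frac{\varepsilon}{2m\ln n}$, $\varepsilon'=\frac{\varepsilon}{8\|C\|_\infty}$. 2. Define $\tilde p_k=\left(1-\frac{\varepsilon'}{4m}\right)p_k+\frac{\varepsilon'}{4mn}\mathbf 1$, $k=1,\dots,m$. 3. Apply PD-AAM (below) to the dual problem $\min_U\phi(U)$ with marginals $\tilde p_k$, until the stopping criterion $2\sum_{k=1}^m\|p_k(\widehat X^t)-\tilde p_k\|_1+F(\widehat X^t)+\phi(\eta^t)\le\varepsilon/2$ holds. 4. Let $\widehat X$ be obtained from $\widehat X^t$ by the rounding procedure (below) with marginals $p_1,\dots,p_m$, which serves as projection onto $\{X\in\mathbb{R}_+^{n\times\cdots\times n}:p_k(X)=p_k,\ k=1,\dots,m\}$. Output $\widehat X$. Here $F(X)=\langle C,X\rangle+\gamma\langle X,\log X\rangle$ and, for $U=(u_1,\dots,u_m)\in(\mathbb{R}^n)^m$, $B(U)$ is the tensor with entries $B_{i_1,\dots,i_m}(U)=\exp\left\{\sum_{k=1}^m[u_k]_{i_k}-C_{i_1\ldots i_m}/\gamma\right\}$, $\Sigma(U)$ is the sum of all its entries, $X(U)=B(U)/\Sigma(U)$ is the primal reconstruction, and $$\phi(U)=\gamma\left[\ln\Sigma(U)-\sum_{k=1}^mu_k^T\tilde p_k\right].$$ PD-AAM (primal-dual accelerated alternating minimization). Set $A_0=0$, $\eta^0=\zeta^0=\theta^0=0\in\mathbb{R}^{mn}$. For $t\ge0$: - $\beta_t=\arg\min_{\beta\in[0,1]}\phi(\eta^t+\beta(\zeta^t-\eta^t))$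 and $\theta^t=\eta^t+\beta_t(\zeta^t-\eta^t)$; - $I=\arg\max_{i\in\{1,\dots,m\}}\left\|\frac{\partial\phi}{\partial u_i}(\theta^t)\right\|_2$; - $\eta^{t+1}_i=\theta^t_i+\ln\tilde p_i-\ln p_i(B(\theta^t))$ for $i=I$, and $\eta^{t+1}_i=\theta^t_i$ otherwise; - $a_{t+1}$ is the largest root of $\phi(\theta^t)-\frac{a_{t+1}^2}{2(A_t+a_{t+1})}\|\nabla\phi(\theta^t)\|_2^2=\phi(\eta^{t+1})$, and $A_{t+1}=A_t+a_{t+1}$; - $\zeta^{t+1}=\zeta^t-a_{t+1}\nabla\phi(\theta^t)$; - $\widehat X^{t+1}=\frac{a_{t+1}X(\theta^t)+A_t\widehat X^t}{A_{t+1}}$. Rounding procedure, applied to a tensor $V$ with marginals $p_1,\dots,p_m$: set $V_1=V$; for $r=1,\dots,m-1$ let $[x_r]_i=\min\{[p_r]_i/[p_r(V_r)]_i,1\}$ and $(V_{r+1})_{i_1,\dots,i_m}=[x_r]_{i_r}(V_r)_{i_1,\dots,i_m}$; for $r=1,\dots,m$ set $\mathrm{err}_r=p_r-p_r(V_m)$; output $V_m+\bigotimes_{r=1}^m\mathrm{err}_r/\|\mathrm{err}_m\|_1^{m-1}$, where $\bigotimes$ is the tensor product. $\widetilde O(\cdot)$ hides logarithmic factors; the quantity $1+\frac{\varepsilon}{4m\|C\|_\infty\ln n}\ln\frac{32mn\|C\|_\infty}{\varepsilon}$ is regarded as $O(1)$, since $\varepsilon$ is small and $m,n$ are large. The cost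 of one iteration is counted as that of its dominating operation, the computation of the full dual gradient, i.e. of the $m$ marginals $p_k(B(U))$ of the tensor $B(U)$, which is $O(mn^m)$.
   Formalization: Corrected: the marginal residual in the stopping criterion is weighted by ‖C‖_∞; rounding rescales all m directions, not m−1; if the dual gradient vanishes, the step is its limit (X̂ = X(θ)). Assumed: n ≥ 2 and ε ≤ 32m‖C‖_∞, so the algorithm is well defined. *)

(* Defs.v *)
(* MathComp / MathComp-Analysis *)
From mathcomp Require Import all_boot all_order all_algebra.
From mathcomp Require Import all_classical all_reals all_analysis.

Set Implicit Arguments.
Unset Strict Implicit.
Unset Printing Implicit Defensive.
Import Order.TTheory GRing.Theory Num.Theory.
Import numFieldNormedType.Exports.
Local Open Scope ring_scope.

Notation multi_index m n := {ffun 'I_m -> 'I_n}.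

Notation tensor R m n := {ffun multi_index m n -> R}.

(* A family of m vectors of R^n (marginals p_1..p_m, dual variables u_1..u_m)
   is an m x n matrix: its k-th row is the k-th vector. *)

Section MOT.
Variables (R : realType) (m n : nat).
Implicit Types (C X V : tensor R m n) (p U G : 'M[R]_(m, n)).

Definition in_simplex (u : 'rV[R]_n) : Prop :=
  (forall j, 0 <= u 0 j) /\ \sum_j u 0 j = 1.

Definition nonneg X : Prop := forall i, 0 <= X i.

Definition marginals X : 'M[R]_(m, n) :=
  \matrix_(k, j) \sum_(i : multi_index m n | i k == j) X i.

Definition inner C X : R := \sum_i C i * X i.

Definition normoo C : R := \big[Num.max/0]_i `|C i|.

Definition norm1 (u : 'rV[R]_n) : R := \sum_j `|u 0 j|.

Definition norm2 (u : 'rV[R]_n) : R := Num.sqrt (\sum_j u 0 j ^+ 2).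

Definition feasible p X : Prop := nonneg X /\ marginals X = p.

Definition optimal C p X : Prop :=
  feasible p X /\ forall Y, feasible p Y -> inner C X <= inner C Y.

Definition approx_solution C p (eps : R) X : Prop :=
  feasible p X /\
  exists2 Xopt, optimal C p Xopt & inner C X <= inner C Xopt + eps.

(* [ln] is 0 at 0, so 0 log 0 = 0. *)
Definition F C (gamma : R) X : R :=
  inner C X + gamma * \sum_i X i * ln (X i).

Definition B C (gamma : R) U : tensor R m n :=
  [ffun i : multi_index m n => expR (\sum_k U k (i k) - C i / gamma)].

Definition Sigma C (gamma : R) U : R := \sum_i B C gamma U i.

Definition primal C (gamma : R) U : tensor R m n :=
  (Sigma C gamma U)^-1 *: B C gamma U.

Definition phi C (gamma : R) p U : R :=
  gamma * (ln (Sigma C gamma U) - \sum_k \sum_j U k j * p k j).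

(* Row k is the partial gradient with respect to u_k. *)
Definition grad (f : 'M[R]_(m, n) -> R) U : 'M[R]_(m, n) :=
  \matrix_(k, j) derive1 (fun h : R => f (U + h *: delta_mx k j)) 0.

Definition sqnorm2 G : R := \sum_k \sum_j G k j ^+ 2.

(* Operation counting: a counted computation returns its value together with
   the number of arithmetic operations performed. *)
Definition csum (s : seq R) : R * nat :=
  foldl (fun acc x => (acc.1 + x, acc.2.+1)) (0, 0%N) s.

(* The three extra operations are /, - and exp. *)
Definition B_entry_ops C (gamma : R) U (i : multi_index m n) : R * nat :=
  let s := csum [seq U k (i k) | k <- enum 'I_m] in
  (expR (s.1 - C i / gamma), (s.2 + 3)%N).

(* Each entry of B(U) is computed once, then accumulated into m marginals. *)
Definition marginals_ops C (gamma : R) U : 'M[R]_(m, n) * nat :=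
  let b i := B_entry_ops C gamma U i in
  let s k j := csum [seq (b i).1 | i <- enum [pred i : multi_index m n | i k == j]] in
  (\matrix_(k, j) (s k j).1,
   (\sum_(i : multi_index m n) (b i).2 + \sum_(k < m) \sum_(j < n) (s k j).2)%N).

Lemma csumE (s : seq R) : csum s = (\sum_(x <- s) x, size s).
Proof.
suff H a c : foldl (fun acc x => (acc.1 + x, acc.2.+1)) (a, c) s =
             (a + \sum_(x <- s) x, (c + size s)%N) by rewrite /csum H add0r add0n.
elim: s a c => [|x s IH] a c /=; first by rewrite big_nil addr0 addn0.
by rewrite IH big_cons addrA addnS addSn.
Qed.

Lemma marginals_ops_correct C gamma U :
  (marginals_ops C gamma U).1 = marginals (B C gamma U).
Proof.
apply/matrixP => k j; rewrite !mxE csumE /= big_map big_enum /=.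
apply: eq_bigr => i _.
by rewrite !ffunE /B_entry_ops csumE /= big_map big_enum.
Qed.

(* [X] is the averaged primal iterate; its initial value is irrelevant, as it
   enters the first step with weight A_0 = 0. *)
Record state := State {
  st_A : R; st_eta : 'M[R]_(m, n); st_zeta : 'M[R]_(m, n); st_X : tensor R m n }.

Definition init_state : state := State 0 0 0 0.

Definition line_argmin (f : 'M[R]_(m, n) -> R) (eta zeta : 'M[R]_(m, n))
    (beta : R) : Prop :=
  0 <= beta <= 1 /\
  forall b, 0 <= b <= 1 ->
    f (eta + beta *: (zeta - eta)) <= f (eta + b *: (zeta - eta)).

Definition block_argmax G (I : 'I_m) : Prop :=
  forall k, norm2 (row k G) <= norm2 (row I G).

Definition block_update C gamma p (theta : 'M[R]_(m, n)) (I : 'I_m) :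
    'M[R]_(m, n) :=
  \matrix_(k, j) (if k == I then
      theta k j + ln (p k j) - ln (marginals (B C gamma theta) k j)
    else theta k j).

(* The equation for a_{t+1}; [d] = phi(theta^t) - phi(eta^{t+1}),
   [g2] = squared norm of the gradient. *)
Definition step_root (A g2 d a : R) : Prop :=
  A + a != 0 /\ a ^+ 2 / (2 * (A + a)) * g2 = d.

Definition largest_step_root (A g2 d a : R) : Prop :=
  step_root A g2 d a /\ forall b, step_root A g2 d b -> b <= a.

(* [pdaam_step C gamma p s c s'] : one iteration may lead from [s] to [s'] and
   costs [c] operations, those of the evaluation of the marginals of B(theta).
   Here [p] is the smoothed family entering phi.
   Any choice of the minimizer beta and of the maximizing block is allowed.
   If the gradient vanishes at theta, every a solves the equation for a_{t+1}
   and there is no largest root; the step is then its limit for a -> +oo, where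
   the average is X(theta) (an exact optimum, at which the method stops). *)
Definition pdaam_step C (gamma : R) p (s : state) (c : nat) (s' : state) : Prop :=
  exists (beta : R) (I : 'I_m),
  let f := phi C gamma p in
  let theta := st_eta s + beta *: (st_zeta s - st_eta s) in
  let g := grad f theta in
  let eta' := block_update C gamma p theta I in
  [/\ line_argmin f (st_eta s) (st_zeta s) beta,
      block_argmax g I,
      c = (marginals_ops C gamma theta).2 &
      if g == 0 then s' = State (st_A s) eta' (st_zeta s) (primal C gamma theta)
      else exists2 a : R,
        largest_step_root (st_A s) (sqnorm2 g) (f theta - f eta') a &
        s' = State (st_A s + a) eta' (st_zeta s - a *: g)
               ((st_A s + a)^-1 *:
                  (a *: primal C gamma theta + st_A s *: st_X s)) ].

(* The marginal residual is weighted by ||C||_oo, which makes the three terms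
   homogeneous; for ||C||_oo = 1 the weight is invisible. *)
Definition stopping C (gamma : R) p (eps : R) (s : state) : Prop :=
  2 * normoo C * \sum_k norm1 (row k (marginals (st_X s) - p))
    + F C gamma (st_X s) + phi C gamma p (st_eta s) <= eps / 2.

(* The criterion is only tested for t >= 1, X^0 being undefined. *)
Definition halted C gamma p eps (t : nat) (s : state) : Prop :=
  (0 < t)%N /\ stopping C gamma p eps s.

(* [pdaam_exec C gamma p eps t N s] : [s] can be reached after [t] iterations
   and [N] operations, without the criterion holding before. *)
Inductive pdaam_exec C (gamma : R) p (eps : R) : nat -> nat -> state -> Prop :=
| Exec_init : pdaam_exec C gamma p eps 0 0 init_state
| Exec_step t N s c s' :
    pdaam_exec C gamma p eps t N s -> ~ halted C gamma p eps t s ->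
    pdaam_step C gamma p s c s' ->
    pdaam_exec C gamma p eps t.+1 (N + c) s'.

Definition rescale p V (r : 'I_m) : tensor R m n :=
  [ffun i : multi_index m n =>
    Num.min (p r (i r) / marginals V r (i r)) 1 * V i].

(* All m directions are rescaled before the rank-one correction: this is what
   makes every err_r nonnegative with the same mass, hence the output feasible.
   The sum in the denominator has the single term r = m - 1, i.e. err_m. *)
Definition rounding p V : tensor R m n :=
  let V' := foldl (rescale p) V (enum 'I_m) in
  let err := p - marginals V' in
  let e := \sum_(r < m | r.+1 == m) norm1 (row r err) in
  V' + [ffun i : multi_index m n => (\prod_r err r (i r)) / e ^+ m.-1].

Definition gamma_of (eps : R) : R := eps / (2 * m%:R * ln n%:R).

Definition eps'_of C (eps : R) : R := eps / (8 * normoo C).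

Definition smoothed C p (eps : R) : 'M[R]_(m, n) :=
  let w := eps'_of C eps / (4 * m%:R) in
  (1 - w) *: p + (w / n%:R) *: const_mx 1.

Definition amot_exec C p (eps : R) : nat -> nat -> state -> Prop :=
  pdaam_exec C (gamma_of eps) (smoothed C p eps) eps.

Definition amot_step C p (eps : R) : state -> nat -> state -> Prop :=
  pdaam_step C (gamma_of eps) (smoothed C p eps).

Definition amot_halted C p (eps : R) : nat -> state -> Prop :=
  halted C (gamma_of eps) (smoothed C p eps) eps.

Definition amot_output p (s : state) : tensor R m n := rounding p (st_X s).

(* The logarithmic quantity whose powers are hidden by the soft O. *)
Definition log_factor C (eps : R) : R :=
  1 + ln m%:R + ln n%:R + `|ln (normoo C / eps)|.

End MOT.

(* Main.v *)
Require Import Defs.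
From mathcomp Require Import all_boot all_order all_algebra.
From mathcomp Require Import all_classical all_reals all_analysis.
From mathcomp Require Import ring lra zify.
Set Implicit Arguments.
Unset Strict Implicit.
Unset Printing Implicit Defensive.
Import Order.TTheory GRing.Theory Num.Theory.
Import numFieldNormedType.Exports.
Local Open Scope ring_scope.

(** Write r = p(X) - p for the residual of the averaged primal iterate X (with
    the smoothed marginals p), and let W be the largest cost. The convergence
    proof needs no a priori bound on a dual solution: it follows from the four
    facts that form the invariant [accelerated],
      zeta = - gamma A r,       A (phi(eta) + F(X)) + |zeta|^2 / 2 <= 0,
      t^2 <= 8 gamma m A,       X >= 0 with total mass 1 (as soon as A > 0).
    The second one is the estimate-sequence inequality of accelerated methods
    with the minimum of the estimate function written out: that function is
    quadratic, its minimizer is zeta, and by Fenchel duality the linear model of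
    phi at theta has constant term - F(X(theta)) ([F_primal_add_phi]), so that
    convexity of F brings in the average X. It is preserved by a step because
    the line search makes the gradient at theta nonnegative in the direction
    zeta - theta ([line_argmin_grad]), and because the step size is chosen to
    make the quadratic terms cancel. The third one holds because a block update
    minimizes phi exactly in one block and so decreases it by gamma times a
    relative entropy, which dominates the squared gradient ([phi_descent]);
    then the step sizes make sqrt A grow linearly ([quadratic_growth]).

    Substituting zeta in the second fact and completing the square in each
    coordinate of r gives
      2 W |r|_1 + F(X) + phi(eta) <= 2 W^2 m n / (gamma^2 A),
    so the criterion holds once t is of order m^2 sqrt n W / eps up to
    logarithms ([iterations_le]); an iteration costs (2 m + 3) n^m operations.
    If the gradient vanishes at theta, the step reaches an exact optimum, at
    which the criterion holds ([solved_halted]).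

    For the quality of the output ([approx_of_criterion]), rounding costs at
    most W/2 per unit of marginal error ([rounding_cost]), and mixing an optimal
    plan with the uniform plan gives a plan with the smoothed marginals, to
    which weak duality applies. The constants of the method suffice
    because F(X) + phi(eta) <= 0 at every iterate: although the criterion allows
    eps/2 for this sum, it then only serves to bound the residual. *)

(** * Entropy inequalities *)

Lemma ln_le_sub1 (R : realType) (x : R) : 0 < x -> ln x <= x - 1.
Proof.
move=> x0; rewrite -[X in ln X](subrKC 1).
by apply: le_ln1Dx; rewrite ltrBrDl subrr.
Qed.

(** The tangent inequality of x ln x at z; the logarithm of 0 being 0, it
    persists at x = 0. Convexity of the entropy, nonnegativity of relative
    entropy and the bound of entropy by its uniform value are instances. *)
Lemma sub_le_mul_lnB (R : realType) (x z : R) :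
  0 <= x -> 0 < z -> x - z <= x * (ln x - ln z).
Proof.
move=> x0 z0; move: x0; rewrite le_eqVlt => /predU1P[<-|x0].
  by rewrite mul0r sub0r oppr_le0 ltW.
have := ln_le_sub1 (divr_gt0 z0 x0); rewrite ln_div ?posrE// => h.
have := ler_wpM2l (ltW x0) h; rewrite !mulrBr mulr1 mulrCA divff ?gt_eqF// mulr1.
lra.
Qed.

(** A termwise substitute for Pinsker's inequality: the right-hand side is at
    least (sqrt p - sqrt q)^2, by the tangent inequality at the square roots,
    and sqrt p + sqrt q <= 2. *)
Lemma quarter_sqr_le_mul_lnB (R : realType) (p q : R) : 0 < p <= 1 -> 0 < q <= 1 ->
  (p - q) ^+ 2 / 4 <= p * (ln p - ln q) - p + q.
Proof.
move=> /andP[p0 p1] /andP[q0 q1].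
have sqrt_bound (x : R) : 0 < x <= 1 ->
    exists s, [/\ 0 < s, s <= 1, x = s ^+ 2 & ln x = 2 * ln s].
  move=> /andP[x0 x1]; exists (Num.sqrt x); rewrite sqrtr_gt0 x0.
  have s1 : Num.sqrt x <= 1 by rewrite -(sqrtr1 R) ler_sqrt.
  split=> //; first by rewrite sqr_sqrtr// ltW.
  by rewrite -{1}(sqr_sqrtr (ltW x0)) lnXn ?sqrtr_gt0// mulr_natl.
have [|s [s0 s1 -> ->]] := sqrt_bound p; first by rewrite p0.
have [|r [r0 r1 -> ->]] := sqrt_bound q; first by rewrite q0.
have := ler_wpM2l (ltW s0) (sub_le_mul_lnB (ltW s0) r0).
have sr : (s + r) ^+ 2 <= 4 by nra.
have := ler_wpM2l (sqr_ge0 (s - r)) sr.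
have -> : (s ^+ 2 - r ^+ 2) ^+ 2 = (s - r) ^+ 2 * (s + r) ^+ 2 by ring.
nra.
Qed.

Lemma le1_of_sum1 (R : realType) (I : finType) (q : I -> R) j :
  (forall i, 0 <= q i) -> \sum_i q i = 1 -> q j <= 1.
Proof. by move=> q0 <-; rewrite (bigD1 j)//= lerDl sumr_ge0. Qed.

(** * Inner product of families of vectors *)

Section InnerProduct.
Variables (R : realType) (m n : nat).
Implicit Types (U V G : 'M[R]_(m, n)).

Definition mxdot U V : R := \sum_k \sum_j U k j * V k j.

Lemma mxdotDl U V G : mxdot (U + V) G = mxdot U G + mxdot V G.
Proof.
rewrite -big_split; apply: eq_bigr => k _.
by rewrite -big_split; apply: eq_bigr => j _; rewrite mxE mulrDl.
Qed.

Lemma mxdotZl (a : R) U G : mxdot (a *: U) G = a * mxdot U G.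
Proof.
rewrite mulr_sumr; apply: eq_bigr => k _.
by rewrite mulr_sumr; apply: eq_bigr => j _; rewrite mxE mulrA.
Qed.

Lemma mxdotC U V : mxdot U V = mxdot V U.
Proof. by apply: eq_bigr => k _; apply: eq_bigr => j _; rewrite mulrC. Qed.

Lemma mxdotNl U G : mxdot (- U) G = - mxdot U G.
Proof. by rewrite -scaleN1r mxdotZl mulN1r. Qed.

Lemma mxdotBr U V G : mxdot U (V - G) = mxdot U V - mxdot U G.
Proof. by rewrite mxdotC mxdotDl mxdotNl ![mxdot _ U]mxdotC. Qed.

Lemma mxdot0 U : mxdot U 0 = 0.
Proof. by rewrite mxdotC -(scale0r 0) mxdotZl mul0r. Qed.

Lemma mxdot_delta k j U : mxdot (delta_mx k j) U = U k j.
Proof.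
rewrite /mxdot (bigD1 k)//= [X in _ + X]big1 ?addr0; last first.
  by move=> l /negbTE kl; rewrite big1// => i _; rewrite mxE kl mul0r.
rewrite (bigD1 j)//= [X in _ + X]big1 ?addr0; last first.
  by move=> l /negbTE kl; rewrite mxE kl andbF mul0r.
by rewrite mxE !eqxx mul1r.
Qed.

Lemma sqnorm2E U : sqnorm2 U = mxdot U U.
Proof. by []. Qed.

Lemma sqnorm2_ge0 U : 0 <= sqnorm2 U.
Proof. by do 2 (apply: sumr_ge0 => ? _); exact: sqr_ge0. Qed.

Lemma sqnorm2_eq0 U : (sqnorm2 U == 0) = (U == 0).
Proof.
apply/idP/eqP => [|->]; last first.
  by rewrite sqnorm2E mxdot0.
have row_ge0 k : 0 <= \sum_j U k j ^+ 2 by apply: sumr_ge0 => j _; exact: sqr_ge0.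
rewrite psumr_eq0// => /allP U0; apply/matrixP => k j; rewrite mxE.
have := U0 k (mem_index_enum _); rewrite /= psumr_eq0; last by move=> *; exact: sqr_ge0.
by move=> /allP /(_ j (mem_index_enum _)); rewrite /= sqrf_eq0 => /eqP.
Qed.

Lemma sqnorm2_le_block G I : block_argmax G I ->
  sqnorm2 G <= m%:R * \sum_j G I j ^+ 2.
Proof.
move=> GI; rewrite mulr_natl -[m in _ *+ m]card_ord -sumr_const.
apply: ler_sum => k _.
have normE l : norm2 (row l G) ^+ 2 = \sum_j G l j ^+ 2.
  rewrite sqr_sqrtr; last by apply: sumr_ge0 => j _; exact: sqr_ge0.
  by apply: eq_bigr => j _; rewrite mxE.
by rewrite -!normE lerXn2r ?nnegrE ?sqrtr_ge0.
Qed.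

Lemma exists_block_argmax G : (0 < m)%N -> exists I, block_argmax G I.
Proof.
move=> m0; have [I _ GI] := @arg_maxP _ _ _ (Ordinal m0) xpredT
  (fun k => norm2 (row k G)) isT.
by exists I => k; exact: GI.
Qed.

End InnerProduct.

(** * Tensors and their marginals *)

Section Tensors.
Variables (R : realType) (m n : nat).
Implicit Types (C X V : tensor R m n) (p U G : 'M[R]_(m, n)).

Lemma scale_tensorE (a : R) X i : (a *: X) i = a * X i.
Proof. by rewrite ffunE. Qed.

Lemma add_tensorE X Y i : (X + Y) i = X i + Y i.
Proof. by rewrite ffunE. Qed.

Lemma marginalsE X k j : marginals X k j = \sum_(i : multi_index m n | i k == j) X i.
Proof. by rewrite mxE. Qed.

Lemma marginalsZ (a : R) X : marginals (a *: X) = a *: marginals X.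
Proof.
apply/matrixP => k j; rewrite !mxE mulr_sumr.
by apply: eq_bigr => i _; rewrite scale_tensorE.
Qed.

Lemma marginalsD X Y : marginals (X + Y) = marginals X + marginals Y.
Proof.
apply/matrixP => k j; rewrite !mxE -big_split.
by apply: eq_bigr => i _; rewrite add_tensorE.
Qed.

Lemma innerZ C (a : R) X : inner C (a *: X) = a * inner C X.
Proof.
by rewrite /inner mulr_sumr; apply: eq_bigr => i _; rewrite scale_tensorE mulrCA.
Qed.

Lemma innerD C X Y : inner C (X + Y) = inner C X + inner C Y.
Proof.
rewrite /inner -big_split; apply: eq_bigr => i _.
by rewrite add_tensorE mulrDr.
Qed.

Lemma sum_marginals X k : \sum_j marginals X k j = \sum_i X i.
Proof.
rewrite (partition_big (fun i : multi_index m n => i k) xpredT)//=.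
by apply: eq_bigr => j _; rewrite marginalsE.
Qed.

(** Taking marginals is adjoint to summing one entry of each vector. *)
Lemma mxdot_marginals U X :
  mxdot U (marginals X) = \sum_i X i * \sum_k U k (i k).
Proof.
rewrite /mxdot.
under [RHS]eq_bigr => i _ do rewrite mulr_sumr.
rewrite [RHS]exchange_big/=; apply: eq_bigr => k _.
rewrite [RHS](partition_big (fun i : multi_index m n => i k) xpredT)//=.
apply: eq_bigr => j _; rewrite marginalsE mulr_sumr.
by apply: eq_bigr => i /eqP <-; rewrite mulrC.
Qed.

Lemma marginals_ge0 X k j : nonneg X -> 0 <= marginals X k j.
Proof. by move=> X0; rewrite marginalsE sumr_ge0. Qed.

Lemma normoo_ge C i : `|C i| <= normoo C.
Proof. by rewrite /normoo; exact: (le_bigmax_cond _ (fun i => `|C i|)). Qed.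

Lemma inner_le_normoo C X : nonneg X -> inner C X <= normoo C * \sum_i X i.
Proof.
move=> X0; rewrite mulr_sumr; apply: ler_sum => i _.
by apply: ler_wpM2r => //; exact: le_trans (ler_norm _) (normoo_ge _ _).
Qed.

Lemma inner_ge0 C X : nonneg C -> nonneg X -> 0 <= inner C X.
Proof. by move=> C0 X0; apply: sumr_ge0 => i _; rewrite mulr_ge0. Qed.

Lemma card_multi_index : #|{: multi_index m n}| = (n ^ m)%N.
Proof. by rewrite card_ffun !card_ord. Qed.

Lemma marginals_gt0 X k j : (forall i, 0 < X i) -> 0 < marginals X k j.
Proof.
move=> X0; rewrite marginalsE (bigD1 [ffun=> j]) ?ffunE//=.
by rewrite ltr_wpDr// sumr_ge0// => i _; exact: ltW.
Qed.

Lemma normoo_ge0 C : 0 <= normoo C.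
Proof. exact: bigmax_ge_id. Qed.

Lemma norm1_row U k : norm1 (row k U) = \sum_j `|U k j|.
Proof. by apply: eq_bigr => j _; rewrite mxE. Qed.

End Tensors.

(** * The dual function and its gradient *)

Lemma is_derive_bigsum (R : realType) (I : Type) (s : seq I)
    (f : I -> R -> R) (df : I -> R) (x : R) :
  (forall i, is_derive x 1 (f i) (df i)) ->
  is_derive x 1 (fun h => \sum_(i <- s) f i h) (\sum_(i <- s) df i).
Proof.
move=> fdf; elim: s => [|i s IH].
  rewrite big_nil (_ : (fun _ => _) = cst 0); first exact: is_derive_cst.
  by apply/funext => h; rewrite big_nil.
rewrite big_cons (_ : (fun _ => _) = f i + (fun h => \sum_(j <- s) f j h)).
  exact: is_deriveD.
by apply/funext => h; rewrite big_cons.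
Qed.

Section DualFunction.
Variables (R : realType) (m n : nat) (C : tensor R m n) (gamma : R).
Variable (p : 'M[R]_(m, n)).
Hypotheses (n_gt0 : (0 < n)%N) (gamma_gt0 : 0 < gamma).
Implicit Types (X V : tensor R m n) (U D eta zeta theta : 'M[R]_(m, n)).

Let f := phi C gamma p.

Lemma B_gt0 U i : 0 < B C gamma U i.
Proof. by rewrite ffunE expR_gt0. Qed.

Lemma Sigma_gt0 U : 0 < Sigma C gamma U.
Proof.
rewrite /Sigma (bigD1 [ffun=> Ordinal n_gt0])//= ltr_wpDr ?B_gt0//.
by apply: sumr_ge0 => i _; rewrite ltW ?B_gt0.
Qed.

Lemma primalE U i : primal C gamma U i = B C gamma U i / Sigma C gamma U.
Proof. by rewrite scale_tensorE mulrC. Qed.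

Lemma primal_gt0 U i : 0 < primal C gamma U i.
Proof. by rewrite primalE divr_gt0 ?B_gt0 ?Sigma_gt0. Qed.

Lemma sum_primal U : \sum_i primal C gamma U i = 1.
Proof.
under eq_bigr => i _ do rewrite primalE.
by rewrite -mulr_suml divff// gt_eqF ?Sigma_gt0.
Qed.

Lemma ln_primal U i : ln (primal C gamma U i) =
  \sum_k U k (i k) - C i / gamma - ln (Sigma C gamma U).
Proof. by rewrite primalE ln_div ?posrE ?B_gt0 ?Sigma_gt0// ffunE expRK. Qed.

Lemma marginals_primal theta :
  marginals (primal C gamma theta) =
  (Sigma C gamma theta)^-1 *: marginals (B C gamma theta).
Proof. exact: marginalsZ. Qed.

Lemma sum_marginals_primal theta k :
  \sum_j marginals (primal C gamma theta) k j = 1.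
Proof. by rewrite sum_marginals sum_primal. Qed.

Lemma marginals_primal_gt0 theta k j : 0 < marginals (primal C gamma theta) k j.
Proof. by apply: marginals_gt0 => i; exact: primal_gt0. Qed.

(** The logarithm of the primal reconstruction is affine in the cost and in
    [U], so the gap F + phi is gamma times the relative entropy of [X] with
    respect to it, up to a term linear in the residual of [X]. *)
Lemma F_add_phi X U : \sum_i X i = 1 ->
  F C gamma X + f U =
  gamma * \sum_i X i * (ln (X i) - ln (primal C gamma U i))
  + gamma * mxdot U (marginals X - p).
Proof.
move=> X1; rewrite /F /f /phi -/(mxdot U p) mxdotBr mxdot_marginals.
have -> : \sum_i X i * (ln (X i) - ln (primal C gamma U i)) =
    \sum_i X i * ln (X i) - \sum_i X i * \sum_k U k (i k)
    + gamma^-1 * inner C X + ln (Sigma C gamma U).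
  rewrite -[ln (Sigma _ _ _)]mul1r -X1 mulr_suml mulr_sumr -sumrB -!big_split/=.
  apply: eq_bigr => i _; rewrite ln_primal; ring.
by field; rewrite gt_eqF.
Qed.

Lemma weak_duality X U : nonneg X -> \sum_i X i = 1 -> marginals X = p ->
  - f U <= F C gamma X.
Proof.
move=> X0 X1 Xp; rewrite -subr_ge0 opprK F_add_phi// Xp subrr mxdot0 mulr0 addr0.
apply: mulr_ge0; first exact: ltW.
apply: (@le_trans _ _ (\sum_i (X i - primal C gamma U i))).
  by rewrite sumrB X1 sum_primal subrr.
apply: ler_sum => i _; exact: sub_le_mul_lnB (primal_gt0 _ _).
Qed.

Lemma is_derive_phi_line U D (x : R) :
  is_derive x 1 (fun h : R => f (U + h *: D))
    (gamma * mxdot D (marginals (primal C gamma (U + x *: D)) - p)).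
Proof.
pose d (i : multi_index m n) := \sum_k D k (i k).
pose S h := Sigma C gamma (U + h *: D).
have BE h i : B C gamma (U + h *: D) i = B C gamma U i * expR (h * d i).
  rewrite !ffunE -expRD; congr expR; rewrite addrAC; congr (_ - _).
  by rewrite /d mulr_sumr -big_split; apply: eq_bigr => k _; rewrite !mxE.
have dS : is_derive x 1 S (\sum_i B C gamma (U + x *: D) i * d i).
  apply: is_derive_bigsum => i; under eq_fun => h do rewrite BE.
  have dlin : is_derive x 1 (fun h : R => h * d i) (d i).
    rewrite (_ : (fun _ => _) = d i \*: (id : R -> R)); last first.
      by apply/funext => h; rewrite /= mulrC.
    by rewrite -[X in is_derive _ _ _ X]mulr1; apply: is_deriveZ.
  have := is_deriveZ (B C gamma U i) (is_derive1_comp (is_derive_expR _) dlin).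
  by rewrite BE -mulrA.
have dL : is_derive x 1 (fun h : R => mxdot (U + h *: D) p) (mxdot D p).
  apply: is_derive_bigsum => k; apply: is_derive_bigsum => j.
  rewrite (_ : (fun _ => _) =
    cst (U k j * p k j) + (D k j * p k j) \*: (id : R -> R)); last first.
    by apply/funext => h; rewrite !mxE mulrDl -mulrA [h * _]mulrC.
  rewrite -[X in is_derive _ _ _ X]add0r; apply: is_deriveD.
  by rewrite -[X in is_derive _ _ _ X]mulr1; apply: is_deriveZ.
have := is_deriveZ gamma
  (is_deriveB (is_derive1_comp (is_derive1_ln (Sigma_gt0 _)) dS) dL).
rewrite (_ : _ \*: _ = (fun h : R => f (U + h *: D)))//.
move=> /is_derive_eq; apply; congr (_ * _).
rewrite mxdotBr mxdot_marginals mulr_sumr; congr (_ - _).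
by apply: eq_bigr => i _; rewrite primalE mulrA [_^-1 * _]mulrC.
Qed.

Lemma grad_phi U : grad f U = gamma *: (marginals (primal C gamma U) - p).
Proof.
apply/matrixP => k j; rewrite mxE derive1E.
rewrite (@derive_val _ _ _ _ _ _ _ (is_derive_phi_line U (delta_mx k j) 0)).
by rewrite scale0r addr0 mxdot_delta [RHS]mxE.
Qed.

Lemma mxdot_grad D U :
  mxdot D (grad f U) = gamma * mxdot D (marginals (primal C gamma U) - p).
Proof. by rewrite grad_phi mxdotC mxdotZl mxdotC. Qed.

(** Equality in the Fenchel-Young inequality: the tangent of phi at [U], taken
    at the origin, has the value - F of the primal reconstruction. *)
Lemma F_primal_add_phi U : F C gamma (primal C gamma U) + f U = mxdot U (grad f U).
Proof.
rewrite mxdot_grad F_add_phi ?sum_primal// big1 ?mulr0 ?add0r// => i _.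
by rewrite subrr mulr0.
Qed.

(** * Line search *)

Lemma line_argmin_exists eta zeta : exists beta, line_argmin f eta zeta beta.
Proof.
pose g (h : R) := f (eta + h *: (zeta - eta)).
have g_cont : {within `[0, 1], continuous g}%classic.
  apply: derivable_within_continuous => x _.
  by case: (is_derive_phi_line eta (zeta - eta) x).
have [beta + beta_min] := EVT_min ler01 g_cont.
by rewrite in_itv/= => beta01; exists beta.
Qed.

Lemma line_argmin_le eta zeta beta : line_argmin f eta zeta beta ->
  f (eta + beta *: (zeta - eta)) <= f eta.
Proof.
by case=> _ /(_ 0); rewrite lexx ler01 scale0r addr0; exact.
Qed.

(** First-order optimality on the segment: either the minimizer is [zeta], or
    one can still move towards [zeta] and the derivative in that direction is
    nonnegative. *)
Lemma line_argmin_grad eta zeta beta (theta := eta + beta *: (zeta - eta)) :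
  line_argmin f eta zeta beta -> mxdot (theta - zeta) (grad f theta) <= 0.
Proof.
move=> [/andP[beta0 beta1] beta_min].
have -> : theta - zeta = - (1 - beta) *: (zeta - eta).
  by apply/matrixP => k j; rewrite !mxE; ring.
rewrite mxdotZl mulNr oppr_le0.
move: beta1; rewrite le_eqVlt => /predU1P[->|beta1].
  by rewrite subrr mul0r.
rewrite mulr_ge0 ?subr_ge0 ?(ltW beta1)//.
pose g (h : R) := f (eta + h *: (zeta - eta)).
have dg : is_derive beta 1 g (mxdot (zeta - eta) (grad f theta)).
  by rewrite mxdot_grad; exact: is_derive_phi_line.
have /cvg_dnbhs_at_right cvg_quot :
    (h^-1 *: (g (h *: 1 + beta) - g beta) @[h --> 0^'] -->
       mxdot (zeta - eta) (grad f theta))%classic.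
  by case: dg => + <-.
rewrite -(cvg_lim _ cvg_quot)//; apply: limr_ge; first exact: cvgP cvg_quot.
near=> h; rewrite /= mulr_ge0// ?invr_ge0// subr_ge0; apply: beta_min.
rewrite [_ *: _]mulr1 addr_ge0//= -lerBrDr.
near: h; apply: nbhs_right_le; by rewrite subr_gt0.
Unshelve. all: by end_near. Qed.

(** * Decrease by a block update *)

Hypotheses (p_gt0 : forall k j, 0 < p k j) (p_sum1 : forall k, \sum_j p k j = 1).

(** The update gives B the marginal [p I] in the direction [I], hence the mass 1. *)
Lemma Sigma_block_update theta I : Sigma C gamma (block_update C gamma p theta I) = 1.
Proof.
have mB_gt0 j : 0 < marginals (B C gamma theta) I j.
  by apply: marginals_gt0 => i; exact: B_gt0.
rewrite /Sigma (partition_big (fun i : multi_index m n => i I) xpredT)//=.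
rewrite -(p_sum1 I); apply: eq_bigr => j _.
rewrite -[RHS](divfK (lt0r_neq0 (mB_gt0 j))) {2}marginalsE mulr_sumr.
apply: eq_bigr => i /eqP iI; rewrite !ffunE.
rewrite (bigD1 I)//= mxE eqxx iI [in RHS](bigD1 I)//=.
rewrite -[X in X / _]lnK ?posrE// -[X in _ / X]lnK ?posrE// -expRN -!expRD iI.
congr expR; rewrite (eq_bigr (fun k => theta k (i k))); first by ring.
by move=> k /negbTE kI; rewrite mxE kI.
Qed.

(** The mass of B is 1 after the update, and its logarithm before the update
    turns the marginal of B in the pairing with [p I] into that of the primal
    reconstruction. What remains is gamma times a relative entropy. *)
Lemma phi_block_update theta I :
  f theta - f (block_update C gamma p theta I) =
  gamma * \sum_j p I j * (ln (p I j) - ln (marginals (primal C gamma theta) I j)).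
Proof.
have mB_gt0 j : 0 < marginals (B C gamma theta) I j.
  by apply: marginals_gt0 => i; exact: B_gt0.
rewrite /f /phi -/(mxdot theta p) -/(mxdot (block_update _ _ _ _ _) p).
rewrite Sigma_block_update ln1 -mulrBr; congr (_ * _).
have -> : mxdot (block_update C gamma p theta I) p = mxdot theta p +
    \sum_j p I j * (ln (p I j) - ln (marginals (B C gamma theta) I j)).
  rewrite /mxdot (bigD1 I)//= [\sum_k \sum_j theta k j * p k j](bigD1 I)//= addrAC.
  congr (_ + _); last first.
    by apply: eq_bigr => k /negbTE kI; apply: eq_bigr => j _; rewrite mxE kI.
  rewrite -big_split; apply: eq_bigr => j _; rewrite mxE eqxx /=; ring.
have -> : \sum_j p I j * (ln (p I j) - ln (marginals (primal C gamma theta) I j)) =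
    \sum_j p I j * (ln (p I j) - ln (marginals (B C gamma theta) I j)) +
    ln (Sigma C gamma theta).
  rewrite -[ln (Sigma _ _ _)]mul1r -(p_sum1 I) mulr_suml -big_split.
  apply: eq_bigr => j _; rewrite marginals_primal mxE.
  by rewrite lnM ?posrE ?invr_gt0 ?lnV ?posrE ?Sigma_gt0//=; ring.
ring.
Qed.

(** The gradient in the block [I] is gamma times the difference of the marginals,
    which the relative entropy controls; the block being the largest one, this
    bounds the whole gradient. *)
Lemma phi_descent theta I : block_argmax (grad f theta) I ->
  sqnorm2 (grad f theta) <=
  4 * gamma * m%:R * (f theta - f (block_update C gamma p theta I)).
Proof.
move=> /sqnorm2_le_block /le_trans; apply.
rewrite phi_block_update.
set q := marginals (primal C gamma theta).
have -> : \sum_j grad f theta I j ^+ 2 = gamma ^+ 2 * \sum_j (p I j - q I j) ^+ 2.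
  rewrite mulr_sumr; apply: eq_bigr => j _.
  by rewrite grad_phi !mxE -marginalsE -/q; ring.
have q0 j : 0 < q I j by exact: marginals_primal_gt0.
have q1 : \sum_j q I j = 1 by exact: sum_marginals_primal.
have : \sum_j (p I j - q I j) ^+ 2 / 4 <= \sum_j p I j * (ln (p I j) - ln (q I j)).
  have -> : \sum_j p I j * (ln (p I j) - ln (q I j)) =
      \sum_j (p I j * (ln (p I j) - ln (q I j)) - p I j + q I j).
    by rewrite big_split/= sumrB p_sum1 q1 subrK.
  apply: ler_sum => j _; apply: quarter_sqr_le_mul_lnB.
    by rewrite p_gt0 (le1_of_sum1 _ _ (p_sum1 I))// => l; exact: ltW.
  by rewrite q0 (le1_of_sum1 _ _ q1)// => l; exact: ltW.
rewrite -mulr_suml; set S := \sum_j (_ - _) ^+ 2; set K := \sum_j _ * _ => SK.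
have -> : m%:R * (gamma ^+ 2 * S) = (4 * m%:R * gamma ^+ 2) * (S / 4) by field.
have -> : 4 * gamma * m%:R * (gamma * K) = (4 * m%:R * gamma ^+ 2) * K by ring.
by apply: ler_wpM2l => //; rewrite mulr_ge0 ?sqr_ge0// mulr_ge0.
Qed.

End DualFunction.

(** * Step sizes *)

Section StepSize.
Variable (R : realType).
Implicit Types (A g d a : R).

(** The equation for the step size [a] is quadratic once the denominator is
    cleared: (a g - d)^2 = d^2 + 2 d A g. Its positive root is the largest one. *)
Lemma largest_step_root_exists A g d : 0 <= A -> 0 < g -> 0 < d ->
  exists2 a, 0 < a & largest_step_root A g d a.
Proof.
move=> A0 g0 d0.
pose D := d ^+ 2 + 2 * d * A * g.
have D_ge : d ^+ 2 <= D by rewrite /D lerDl !mulr_ge0// ltW.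
have D0 : 0 <= D by apply: le_trans D_ge; exact: sqr_ge0.
have rootE a : A + a != 0 -> a ^+ 2 / (2 * (A + a)) * g = d <-> (a * g - d) ^+ 2 = D.
  move=> Aa; rewrite /D; split=> [<-|h]; first by field.
  have : a ^+ 2 * g = 2 * (A + a) * d.
    apply: (mulfI (lt0r_neq0 g0)).
    have -> : g * (a ^+ 2 * g) = (a * g - d) ^+ 2 + 2 * a * g * d - d ^+ 2 by ring.
    by rewrite h; ring.
  by move=> h2; rewrite mulrAC h2; field.
have a0 : 0 < (d + Num.sqrt D) / g by rewrite divr_gt0// ltr_wpDr ?sqrtr_ge0.
have Aa : A + (d + Num.sqrt D) / g != 0 by rewrite gt_eqF// ltr_wpDl.
exists ((d + Num.sqrt D) / g) => //; split; first split=> //.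
  by apply/rootE => //; rewrite divfK ?gt_eqF// addrAC subrr add0r sqr_sqrtr.
move=> b [Ab /rootE -/(_ Ab) hb].
rewrite ler_pdivlMr// -lerBlDl (le_trans (ler_norm _))//.
by rewrite -(sqrtr_sqr (b * g - d)) hb.
Qed.

Lemma largest_step_root_gt0 A g d a : 0 <= A -> 0 < g -> 0 < d ->
  largest_step_root A g d a -> 0 < a.
Proof.
move=> A0 g0 d0 [_ amax].
have [b b0 [broot _]] := largest_step_root_exists A0 g0 d0.
exact: lt_le_trans b0 (amax b broot).
Qed.

(** With b = sqrt (A + a), the hypothesis on [a] says that a >= (sqrt tau) b,
    whence A <= (b - sqrt tau / 2)^2: square roots grow by at least
    sqrt tau / 2. *)
Lemma quadratic_growth (A a tau s : R) : 0 <= A -> 0 < a -> 0 <= tau -> 0 <= s ->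
  tau * (A + a) <= a ^+ 2 -> tau * s ^+ 2 <= 4 * A ->
  tau * (s + 1) ^+ 2 <= 4 * (A + a).
Proof.
move=> A0 a0 tau0 s0 ha hA.
have B0 : 0 < A + a by rewrite ltr_wpDl.
pose r := Num.sqrt tau; pose b := Num.sqrt (A + a).
have rE : tau = r ^+ 2 by rewrite sqr_sqrtr.
have bE : A + a = b ^+ 2 by rewrite sqr_sqrtr// ltW.
have r0 : 0 <= r by exact: sqrtr_ge0.
have b0 : 0 < b by rewrite sqrtr_gt0.
have rb : r * b <= a.
  have : (r * b) ^+ 2 <= a ^+ 2 by rewrite exprMn -rE -bE.
  by rewrite ler_pXn2r// ?nnegrE ?(ltW a0)// mulr_ge0// ltW.
have rleb : r <= b.
  by rewrite -(ler_pM2r b0) (le_trans rb)// -expr2 -bE lerDr.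
have : r * s <= 2 * b - r.
  have h : (r * s) ^+ 2 <= (2 * b - r) ^+ 2.
    rewrite exprMn -rE (le_trans hA)// (_ : A = b ^+ 2 - a); last by rewrite -bE; ring.
    nra.
  by move: h; rewrite ler_pXn2r// nnegrE ?mulr_ge0//; lra.
move=> h; have : (r * (s + 1)) ^+ 2 <= (2 * b) ^+ 2.
  rewrite ler_pXn2r// ?nnegrE; [lra| |lra].
  by rewrite mulr_ge0// addr_ge0.
by rewrite exprMn -rE exprMn -bE; lra.
Qed.

End StepSize.

(** * The invariant of accelerated alternating minimization *)

Section Invariant.
Variables (R : realType) (m n : nat) (C : tensor R m n) (gamma : R).
Variable (p : 'M[R]_(m, n)).
Hypotheses (m_gt0 : (0 < m)%N) (n_gt0 : (0 < n)%N) (gamma_gt0 : 0 < gamma).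
Hypotheses (p_gt0 : forall k j, 0 < p k j) (p_sum1 : forall k, \sum_j p k j = 1).
Implicit Types (X Y : tensor R m n) (U eta zeta theta : 'M[R]_(m, n)).
Implicit Types (s : state R m n).

Let f := phi C gamma p.

Lemma F_convex (a A : R) X Y : 0 < a -> 0 <= A -> (forall i, 0 < X i) -> nonneg Y ->
  (A + a) * F C gamma ((A + a)^-1 *: (a *: X + A *: Y)) <=
  a * F C gamma X + A * F C gamma Y.
Proof.
move=> a0 A0 X0 Y0; set Z := _ *: _.
have B0 : 0 < A + a by rewrite ltr_wpDl.
have ZE i : (A + a) * Z i = a * X i + A * Y i.
  by rewrite scale_tensorE mulVKf ?gt_eqF// add_tensorE !scale_tensorE.
have Z0 i : 0 < Z i.
  by rewrite -(pmulr_rgt0 _ B0) ZE ltr_pwDl ?mulr_gt0 ?mulr_ge0.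
have innerE : (A + a) * inner C Z = a * inner C X + A * inner C Y.
  rewrite -!innerZ -innerD; apply: eq_bigr => i _; congr (_ * _).
  by rewrite scale_tensorE ZE add_tensorE !scale_tensorE.
rewrite /F mulrDr innerE mulrCA.
suff : (A + a) * (\sum_i Z i * ln (Z i)) <=
    a * \sum_i X i * ln (X i) + A * \sum_i Y i * ln (Y i).
  by move=> /(ler_wpM2l (ltW gamma_gt0)); lra.
rewrite !mulr_sumr -big_split; apply: ler_sum => i _.
have := ler_wpM2l (ltW a0) (sub_le_mul_lnB (ltW (X0 i)) (Z0 i)).
have := ler_wpM2l A0 (sub_le_mul_lnB (Y0 i) (Z0 i)).
have -> : (A + a) * (Z i * ln (Z i)) = (a * X i + A * Y i) * ln (Z i).
  by rewrite mulrA ZE.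
have := ZE i; rewrite /=; lra.
Qed.

(** What holds as long as no gradient has vanished. [acc_gap] is the inequality
    of the estimate-sequence method at the minimizer zeta of the estimate
    function; [acc_X_sum] is weighted by A because the averaged iterate starts
    at 0, with A = 0. *)
Record accelerated (t : nat) s : Prop := Accelerated {
  acc_A_ge0 : 0 <= st_A s;
  acc_A_growth : t%:R ^+ 2 <= 8 * gamma * m%:R * st_A s;
  acc_zeta : st_zeta s = - (gamma * st_A s) *: (marginals (st_X s) - p);
  acc_gap : st_A s * (f (st_eta s) + F C gamma (st_X s))
              + sqnorm2 (st_zeta s) / 2 <= 0;
  acc_X_ge0 : nonneg (st_X s);
  acc_X_sum : st_A s * \sum_i st_X s i = st_A s }.

(** A saddle point: what a step from a vanishing gradient produces. *)
Record solved s : Prop := Solved {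
  solved_X_ge0 : nonneg (st_X s);
  solved_X_sum1 : \sum_i st_X s i = 1;
  solved_marginals : marginals (st_X s) = p;
  solved_gap : f (st_eta s) + F C gamma (st_X s) = 0 }.

Lemma accelerated_init : accelerated 0 (init_state R m n).
Proof.
split=> //=.
- by rewrite expr0n mulr0.
- by rewrite mulr0 oppr0 scale0r.
- by rewrite mul0r add0r (eqP (_ : sqnorm2 0 == 0)) ?mul0r// sqnorm2_eq0.
- by move=> i; rewrite ffunE.
- by rewrite mul0r.
Qed.

(** In the regular case, the increase of A phi(eta) + A F(X) + |zeta|^2 / 2 is at
    most a times the inner product of theta - zeta and the gradient: the terms
    quadratic in the gradient cancel by the choice of a, and the constant terms
    combine into that inner product by [F_primal_add_phi]. *)
Lemma pdaam_step_accelerated t s c s' : accelerated t s ->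
  pdaam_step C gamma p s c s' -> accelerated t.+1 s' \/ solved s'.
Proof.
move=> [A0 At zetaE gap X0 X1] [beta [I /=]].
set theta := st_eta s + _; set g := grad _ theta.
set eta' := block_update _ _ _ _ _ => -[beta_min I_max _].
have theta_le := line_argmin_le beta_min.
have grad_le := line_argmin_grad n_gt0 beta_min.
have descent := phi_descent n_gt0 p_gt0 p_sum1 I_max.
have PE := F_primal_add_phi C p n_gt0 gamma_gt0 theta.
rewrite -/theta -/g -/eta' -/f in grad_le theta_le descent PE.
case: ifPn => [g0 ->|g0 [a a_root ->]].
  right; have gE : marginals (primal C gamma theta) = p.
    move: g0; rewrite /g grad_phi// scaler_eq0 gt_eqF//= subr_eq0.
    by move=> /eqP.
  split=> //=.
  - by move=> i; rewrite ltW// primal_gt0.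
  - by rewrite sum_primal.
  have -> : f eta' = f theta.
    apply/eqP; rewrite eq_sym -subr_eq0 /f phi_block_update// gE.
    by rewrite big1 ?mulr0// => j _; rewrite subrr mulr0.
  by rewrite addrC PE (eqP g0) mxdot0.
left; have g2_gt0 : 0 < sqnorm2 g by rewrite lt_def sqnorm2_eq0 g0 sqnorm2_ge0.
have c0 : 0 < 4 * gamma * m%:R by rewrite !mulr_gt0// ltr0n.
have d_gt0 : 0 < phi C gamma p theta - phi C gamma p eta'.
  by rewrite -(pmulr_rgt0 _ c0); exact: lt_le_trans descent.
have a0 := largest_step_root_gt0 A0 g2_gt0 d_gt0 a_root.
case: a_root => -[Aa a_eq] _.
set A := st_A s in A0 At zetaE gap X1 a_eq Aa *.
have B0 : 0 < A + a by rewrite ltr_wpDl.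
(* Since a^2 / (A + a) is twice the decrease of phi divided by the squared
   gradient, the guaranteed decrease bounds it from below. *)
have tau_le : (2 * gamma * m%:R)^-1 * (A + a) <= a ^+ 2.
  move: descent; rewrite -a_eq mulrA -[X in X <= _]mul1r ler_pM2r// => h.
  rewrite mulrC ler_pdivrMr ?mulr_gt0 ?ltr0n//.
  rewrite -(ler_pM2r (_ : 0 < (A + a)^-1)) ?invr_gt0// divff//.
  apply: le_trans h _; rewrite le_eqVlt; apply/orP; left; apply/eqP.
  by field.
have sum_primal1 := sum_primal C gamma n_gt0 theta.
have X'E i : ((A + a)^-1 *: (a *: primal C gamma theta + A *: st_X s)) i =
    (a * primal C gamma theta i + A * st_X s i) / (A + a).
  by rewrite scale_tensorE mulrC add_tensorE !scale_tensorE.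
split=> /=.
- exact: ltW.
- have tau0 : 0 <= (2 * gamma * m%:R)^-1 by rewrite invr_ge0 !mulr_ge0// ltW.
  have hA : (2 * gamma * m%:R)^-1 * t%:R ^+ 2 <= 4 * A.
    rewrite mulrC ler_pdivrMr ?mulr_gt0 ?ltr0n//; by apply: le_trans At _; lra.
  have := quadratic_growth A0 a0 tau0 (ler0n _ _) tau_le hA.
  rewrite natr1 mulrC ler_pdivrMr ?mulr_gt0 ?ltr0n// => /le_trans; apply; lra.
- rewrite zetaE /g grad_phi// (marginalsZ (A + a)^-1) marginalsD.
  rewrite (marginalsZ a) (marginalsZ A).
  by apply/matrixP => k j; rewrite !mxE; field.
- have convex := F_convex a0 A0 (primal_gt0 C gamma n_gt0 theta) X0.
  have -> : sqnorm2 (st_zeta s - a *: g) = sqnorm2 (st_zeta s)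
      - 2 * a * mxdot (st_zeta s) g + a ^+ 2 * sqnorm2 g.
    rewrite !sqnorm2E mxdotDl mxdotNl mxdotZl ![mxdot _ (st_zeta s - _)]mxdotC.
    rewrite !mxdotDl !mxdotNl !mxdotZl [mxdot g (st_zeta s)]mxdotC; ring.
  (* [acc_gap] for the new state is the sum of the following inequalities, of
     [gap] and [convex], and of a times [PE]. *)
  move: grad_le; rewrite mxdotDl mxdotNl => /(ler_wpM2l (ltW a0)).
  have : (A + a) * (f theta - f eta') = a ^+ 2 / 2 * sqnorm2 g.
    by rewrite /f -a_eq; field.
  have := ler_wpM2l A0 theta_le; rewrite -/f.
  move: gap convex PE; nra.
- move=> i; rewrite X'E divr_ge0 ?ltW// ltr_pwDl ?mulr_gt0 ?primal_gt0//.
  by rewrite mulr_ge0.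
- under eq_bigr => i _ do rewrite X'E.
  rewrite -mulr_suml big_split/= -!mulr_sumr sum_primal1 mulr1 X1.
  by rewrite mulrCA [a + _]addrC divff ?gt_eqF// mulr1.
Qed.

End Invariant.

(** * Number and cost of the iterations *)

Section Iterations.
Variables (R : realType) (m n : nat) (C : tensor R m n) (gamma : R).
Variables (p : 'M[R]_(m, n)) (eps : R).
Hypotheses (m_gt0 : (0 < m)%N) (n_gt0 : (0 < n)%N) (gamma_gt0 : 0 < gamma).
Hypotheses (p_gt0 : forall k j, 0 < p k j) (p_sum1 : forall k, \sum_j p k j = 1).
Hypothesis eps_gt0 : 0 < eps.
Implicit Types (s : state R m n).

Let f := phi C gamma p.

Lemma accelerated_A_gt0 t s : (0 < t)%N -> accelerated C gamma p t s -> 0 < st_A s.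
Proof.
move=> t0 acc; have : 0 < 8 * gamma * m%:R * st_A s.
  by apply: lt_le_trans (acc_A_growth acc); rewrite exprn_gt0 ?ltr0n.
by rewrite pmulr_rgt0// !mulr_gt0// ltr0n.
Qed.

(** The gap is at most - c |r|_2^2 / 2 with c = gamma^2 A, and this pays for the
    l1 penalty coordinate by coordinate, by Young's inequality. *)
Lemma accelerated_criterion t s : accelerated C gamma p t s -> 0 < st_A s ->
  2 * normoo C * \sum_k norm1 (row k (marginals (st_X s) - p))
    + F C gamma (st_X s) + f (st_eta s)
  <= 2 * normoo C ^+ 2 * m%:R * n%:R / (gamma ^+ 2 * st_A s).
Proof.
move=> [_ _ zetaE + _ _] A0.
set r := _ - p in zetaE *; set A := st_A s in A0 zetaE *; set W := normoo C.
set c := gamma ^+ 2 * A.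
have c0 : 0 < c by rewrite mulr_gt0 ?exprn_gt0.
have -> : sqnorm2 (st_zeta s) = A * (c * sqnorm2 r).
  by rewrite zetaE !sqnorm2E mxdotZl mxdotC mxdotZl /c; ring.
rewrite -mulrA -mulrDr pmulr_rle0// -/f => gap.
have young x : 2 * W * `|x| <= c * x ^+ 2 / 2 + 2 * W ^+ 2 / c.
  rewrite -subr_ge0 (_ : _ - _ = (c * `|x| - 2 * W) ^+ 2 / (2 * c)).
    by rewrite divr_ge0 ?sqr_ge0 ?(mulr_ge0 _ (ltW c0)).
  by rewrite -[x ^+ 2]real_normK ?num_real//; field; rewrite gt_eqF.
have : 2 * W * \sum_k norm1 (row k r) <=
    c * sqnorm2 r / 2 + 2 * W ^+ 2 * m%:R * n%:R / c.
  have -> : 2 * W ^+ 2 * m%:R * n%:R / c = \sum_(k < m) \sum_(j < n) 2 * W ^+ 2 / c.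
    rewrite !(sumr_const, card_ord) -mulr_natl -[_ *+ n]mulr_natl; ring.
  rewrite !mulr_sumr mulr_suml -big_split; apply: ler_sum => k _.
  rewrite norm1_row /= !mulr_sumr mulr_suml -big_split; apply: ler_sum => j _.
  exact: young.
lra.
Qed.

Lemma accelerated_not_halted t s : accelerated C gamma p t s ->
  ~ halted C gamma p eps t s ->
  gamma * eps * t%:R ^+ 2 <= 32 * normoo C ^+ 2 * m%:R ^+ 2 * n%:R.
Proof.
move=> acc not_halted; case: (posnP t) => [->|t0].
  by rewrite expr0n mulr0 !mulr_ge0 ?exprn_ge0 ?normoo_ge0.
have M0 : 0 < m%:R :> R by rewrite ltr0n.
have := acc_A_growth acc.
have A0 := accelerated_A_gt0 t0 acc.
have c0 : 0 < gamma ^+ 2 * st_A s by rewrite mulr_gt0 ?exprn_gt0.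
have : eps / 2 <= 2 * normoo C ^+ 2 * m%:R * n%:R / (gamma ^+ 2 * st_A s).
  rewrite leNgt; apply/negP => crit; apply: not_halted; split=> //.
  exact: le_trans (accelerated_criterion acc A0) (ltW crit).
rewrite ler_pdivlMr// => h1 h2.
have := ler_wpM2l (ltW (mulr_gt0 gamma_gt0 eps_gt0)) h2.
have := ler_wpM2l (ler0n R (16 * m)) h1.
rewrite natrM; lra.
Qed.

Lemma solved_halted t s : (0 < t)%N -> solved C gamma p s ->
  halted C gamma p eps t s.
Proof.
move=> t0 [_ _ Xp gap]; split=> //; rewrite /stopping Xp subrr big1.
  by rewrite mulr0 add0r addrC gap divr_ge0 ?ltW.
by move=> k _; rewrite norm1_row big1// => j _; rewrite mxE normr0.
Qed.

Lemma accelerated_gap_le0 t s : accelerated C gamma p t s -> 0 < st_A s ->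
  F C gamma (st_X s) + f (st_eta s) <= 0.
Proof.
move=> acc A0; rewrite -(pmulr_rle0 _ A0).
by have := acc_gap acc; have := sqnorm2_ge0 (st_zeta s); rewrite /f; lra.
Qed.

Lemma pdaam_step_exists t s : accelerated C gamma p t s ->
  exists c s', pdaam_step C gamma p s c s'.
Proof.
move=> acc.
have [beta beta_min] := line_argmin_exists C gamma p n_gt0 (st_eta s) (st_zeta s).
pose theta := st_eta s + beta *: (st_zeta s - st_eta s).
have [I I_max] := exists_block_argmax (grad f theta) m_gt0.
have descent := phi_descent n_gt0 p_gt0 p_sum1 I_max.
exists (marginals_ops C gamma theta).2.
have [g0|g0] := eqVneq (grad f theta) 0.
  by eexists; exists beta, I; split=> //; rewrite -/f g0 eqxx.
have g_gt0 : 0 < sqnorm2 (grad f theta) by rewrite lt_def sqnorm2_eq0 g0 sqnorm2_ge0.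
have c0 : 0 < 4 * gamma * m%:R by rewrite !mulr_gt0// ltr0n.
have d_gt0 : 0 < f theta - f (block_update C gamma p theta I).
  by rewrite -(pmulr_rgt0 _ c0); exact: lt_le_trans descent.
have [a _ a_root] := largest_step_root_exists (acc_A_ge0 acc) g_gt0 d_gt0.
by eexists; exists beta, I; split=> //; rewrite -/f (negbTE g0); exists a.
Qed.

(** Every entry of B is computed once, in m + 3 operations, and each of the m
    marginals adds up all the n^m entries. *)
Lemma marginals_ops_cost U :
  (marginals_ops C gamma U).2 = ((2 * m + 3) * n ^ m)%N.
Proof.
rewrite /marginals_ops /=.
under eq_bigr => i _ do rewrite /B_entry_ops csumE /= size_map size_enum_ord.
rewrite sum_nat_const card_multi_index.
have slices (k : 'I_m) :
    (\sum_(j < n) #|[pred i : multi_index m n | i k == j]| = n ^ m)%N.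
  rewrite -card_multi_index -sum1_card.
  rewrite (partition_big (fun i : multi_index m n => i k) xpredT)//=.
  by apply: eq_bigr => j _; rewrite -sum1_card; apply: eq_bigl.
under [X in (_ + X)%N]eq_bigr => k _.
  under eq_bigr => j _ do rewrite csumE /= size_map -cardE.
  rewrite slices; over.
by rewrite sum_nat_const card_ord mulnC -mulnDl addnAC addnn mul2n.
Qed.

(** A state reached through a vanishing gradient meets the criterion, so that
    every further step starts from an accelerated state. *)
Lemma pdaam_exec_inv t N s : pdaam_exec C gamma p eps t N s ->
  accelerated C gamma p t s \/ (0 < t)%N /\ solved C gamma p s.
Proof.
elim=> [|{}t {}N {}s c s' _ IH not_halted step].
  by left; exact: accelerated_init.
case: IH => [acc|[t0 sol]]; last by case: not_halted; exact: solved_halted.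
have [|] := pdaam_step_accelerated m_gt0 n_gt0 gamma_gt0 p_gt0 p_sum1 acc step.
  by left.
by right.
Qed.

Lemma pdaam_exec_cost t N s : pdaam_exec C gamma p eps t N s ->
  N = (t * ((2 * m + 3) * n ^ m))%N.
Proof.
elim=> [|{}t {}N {}s c s' _ -> _ [beta [I [_ _ -> _]]]]; first by rewrite mul0n.
by rewrite marginals_ops_cost mulSn addnC.
Qed.

Lemma pdaam_exec_not_halted t N s : pdaam_exec C gamma p eps t N s ->
  ~ halted C gamma p eps t s -> accelerated C gamma p t s.
Proof.
by move=> /pdaam_exec_inv[//|[t0 sol] []]; exact: solved_halted.
Qed.

(** The last step was taken because the criterion failed after [t] steps. *)
Lemma pdaam_exec_length t N s : pdaam_exec C gamma p eps t.+1 N s ->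
  gamma * eps * t%:R ^+ 2 <= 32 * normoo C ^+ 2 * m%:R ^+ 2 * n%:R.
Proof.
move=> exec; inversion_clear exec as [|? N' s0 ? ? exec' not_halted _].
exact: accelerated_not_halted (pdaam_exec_not_halted exec' not_halted) not_halted.
Qed.

Lemma pdaam_exec_X t N s : (0 < t)%N -> pdaam_exec C gamma p eps t N s ->
  [/\ nonneg (st_X s), \sum_i st_X s i = 1 &
      F C gamma (st_X s) + f (st_eta s) <= 0].
Proof.
move=> t0 /pdaam_exec_inv[acc|[_ [X0 X1 _ gap]]]; last first.
  by split=> //; rewrite addrC gap.
have A0 := accelerated_A_gt0 t0 acc.
split; first exact: acc_X_ge0 acc.
  by apply: (mulfI (lt0r_neq0 A0)); rewrite (acc_X_sum acc) mulr1.
exact: accelerated_gap_le0 acc A0.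
Qed.

End Iterations.

(** * Rounding *)

Section Rounding.
Variables (R : realType) (m n : nat) (p : 'M[R]_(m, n)).
Hypotheses (m_gt0 : (0 < m)%N) (p_simplex : forall k, in_simplex (row k p)).
Implicit Types (C V W : tensor R m n).

Lemma simplex_ge0 k j : 0 <= p k j.
Proof. by have [/(_ j)] := p_simplex k; rewrite mxE. Qed.

Lemma simplex_sum1 k : \sum_j p k j = 1.
Proof. by have [_ <-] := p_simplex k; apply: eq_bigr => j _; rewrite mxE. Qed.

Lemma marginals_le V W k j : (forall i, W i <= V i) -> marginals W k j <= marginals V k j.
Proof. by move=> WV; rewrite !marginalsE; apply: ler_sum. Qed.

Lemma rescale_ge0 V r : nonneg V -> nonneg (rescale p V r).
Proof.
move=> V0 i; rewrite ffunE mulr_ge0// le_min ler01 andbT.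
by rewrite divr_ge0 ?simplex_ge0 ?marginals_ge0.
Qed.

Lemma rescale_le V r i : nonneg V -> rescale p V r i <= V i.
Proof. by move=> V0; rewrite ffunE ler_piMl// ge_min lexx orbT. Qed.

Lemma marginals_rescale V r j : nonneg V ->
  marginals (rescale p V r) r j = Num.min (p r j) (marginals V r j).
Proof.
move=> V0; have q0 := marginals_ge0 r j V0.
have -> : marginals (rescale p V r) r j =
    Num.min (p r j / marginals V r j) 1 * marginals V r j.
  rewrite marginalsE [X in _ * X]marginalsE mulr_sumr.
  by apply: eq_bigr => i /eqP ir; rewrite ffunE ir.
move: q0; rewrite le_eqVlt => /predU1P[<-|q0].
  by rewrite mulr0 min_r ?simplex_ge0.
by rewrite minr_pMl ?(ltW q0)// divfK ?gt_eqF// mul1r.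
Qed.

(** Rescaling in a further direction only lowers the entries, so it keeps the
    bounds already achieved on the other marginals, and the mass it removes is at
    most the excess of the original marginal. *)
Lemma rescale_all V (s : seq 'I_m) (W := foldl (rescale p) V s) : nonneg V ->
  [/\ nonneg W, forall i, W i <= V i,
      forall r j, r \in s -> marginals W r j <= p r j &
      \sum_i V i - \sum_i W i <=
        \sum_(r <- s) \sum_j Num.max (marginals V r j - p r j) 0].
Proof.
move=> V0; rewrite {}/W; elim/last_ind: s => [|s r [W0 WV Wp loss]].
  by split=> //=; rewrite big_nil subrr.
rewrite foldl_rcons; set W := foldl _ _ _ in W0 WV Wp loss *.
have W'W i : rescale p W r i <= W i by exact: rescale_le.
split; first exact: rescale_ge0.
- by move=> i; exact: le_trans (W'W i) (WV i).
- move=> k j; rewrite mem_rcons inE => /predU1P[->|ks].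
    by rewrite marginals_rescale// ge_min lexx.
  exact: le_trans (marginals_le _ _ W'W) (Wp _ _ ks).
rewrite -cats1 big_cat big_seq1 /= -(subrKA (\sum_i W i)).
apply: lerD loss _; rewrite -!(sum_marginals _ r) -sumrB.
apply: ler_sum => j _; rewrite marginals_rescale//.
have := marginals_le r j WV; rewrite le_max minEle.
by case: ifP => _ WVj; apply/orP; [left|right]; lra.
Qed.

(** The correction term of the rounding. When all the vectors of [err] have the
    same sum [e], it is the tensor with marginals [err] that has independent
    coordinates; for [e] = 1 it is a product coupling. *)
Definition rank_one (e : R) (err : 'M[R]_(m, n)) : tensor R m n :=
  [ffun i : multi_index m n => (\prod_r err r (i r)) / e ^+ m.-1].

(** If [e] = 0 then [err] vanishes, and so does the quotient by 0. *)
Lemma marginals_rank_one (e : R) (err : 'M[R]_(m, n)) :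
  (forall k j, 0 <= err k j) -> (forall k, \sum_j err k j = e) ->
  marginals (rank_one e err) = err.
Proof.
move=> err0 err_sum; apply/matrixP => k j.
have prodE : \sum_(i : multi_index m n | i k == j) \prod_r err r (i r) =
    err k j * e ^+ m.-1.
  (* Expand the product over r of the sums of err r, with the k-th sum reduced
     to its term at j. *)
  pose Q (r : 'I_m) : pred 'I_n := if r == k then pred1 j else predT.
  transitivity (\prod_r \sum_(l | Q r l) err r l).
    rewrite bigA_distr_big_dep; apply: eq_bigl => i.
    apply/idP/familyP => [ik r|/(_ k)]; rewrite /Q; last by rewrite eqxx.
    by have [->|] := eqVneq r k.
  rewrite (bigD1 k)//= /Q eqxx big_pred1_eq; congr (_ * _).
  rewrite (eq_bigr (fun=> e)) => [|r /negbTE ->]; last by rewrite err_sum.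
  by rewrite prodr_const cardC1 card_ord.
rewrite marginalsE; under eq_bigr => i _ do rewrite ffunE.
rewrite -mulr_suml prodE; have [e0|e0] := eqVneq e 0; last first.
  by rewrite mulfK// expf_neq0.
have /eqP := err_sum k; rewrite e0 psumr_eq0// => /allP /(_ j (mem_index_enum _)).
by move=> /eqP ->; rewrite !mul0r.
Qed.

Lemma roundingE V : nonneg V -> \sum_i V i = 1 ->
  let W := foldl (rescale p) V (enum 'I_m) in let err := p - marginals W in
  [/\ rounding p V = W + rank_one (1 - \sum_i W i) err,
      forall k j, 0 <= err k j & forall k, \sum_j err k j = 1 - \sum_i W i].
Proof.
move=> V0 V1 W err; have [W0 WV Wp _] := rescale_all (enum 'I_m) V0.
have err0 k j : 0 <= err k j.
  by rewrite /err !mxE subr_ge0 -marginalsE Wp// mem_enum.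
have err_sum k : \sum_j err k j = 1 - \sum_i W i.
  rewrite -(sum_marginals W k) -(simplex_sum1 k) -sumrB.
  by apply: eq_bigr => j _; rewrite !mxE.
split=> //; rewrite /rounding -/W -/err /rank_one; congr (_ + _).
have m1_lt : (m.-1 < m)%N by rewrite ltn_predL.
rewrite (big_pred1 (Ordinal m1_lt)) => [|r]; last first.
  by rewrite /= -[X in (_ == X) = _](prednK m_gt0) eqSS.
rewrite norm1_row (eq_bigr _ (fun j _ => ger0_norm (err0 _ j))) err_sum//.
Qed.

Lemma rounding_feasible V : nonneg V -> \sum_i V i = 1 -> feasible p (rounding p V).
Proof.
move=> V0 V1; have [-> err0 err_sum] := roundingE V0 V1.
have [W0 WV _ _] := rescale_all (enum 'I_m) V0.
split; last by rewrite marginalsD marginals_rank_one// subrKC.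
move=> i; rewrite add_tensorE addr_ge0// ffunE divr_ge0 ?prodr_ge0//.
by rewrite exprn_ge0// -V1 subr_ge0 ler_sum.
Qed.

(** Only the correction term can raise the cost, by at most the largest cost
    times its mass. That mass is the mass lost by the rescalings, and the excess
    of a marginal over another vector of the same mass is half their l1
    distance. *)
Lemma rounding_cost C V : nonneg C -> nonneg V -> \sum_i V i = 1 ->
  inner C (rounding p V) <=
  inner C V + normoo C / 2 * \sum_k norm1 (row k (marginals V - p)).
Proof.
move=> C0 V0 V1; have [-> err0 err_sum] := roundingE V0 V1.
have [W0 WV _ loss] := rescale_all (enum 'I_m) V0.
rewrite innerD lerD//.
  by apply: ler_sum => i _; rewrite ler_wpM2l.
apply: le_trans (inner_le_normoo _ _) _.
  move=> i; rewrite ffunE divr_ge0 ?prodr_ge0//.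
  by rewrite exprn_ge0// -V1 subr_ge0 ler_sum.
rewrite -mulrA ler_wpM2l ?normoo_ge0//.
pose k0 : 'I_m := Ordinal m_gt0.
rewrite -(sum_marginals _ k0) marginals_rank_one// err_sum -V1.
apply: le_trans loss _; rewrite big_enum le_eqVlt; apply/orP; left; apply/eqP.
rewrite mulrC mulr_suml; apply: eq_bigr => k _.
rewrite norm1_row.
have posE (x : R) : Num.max x 0 = (`|x| + x) / 2.
  by rewrite maxEle; case: (leP x 0) => [/ler0_norm|/gtr0_norm] ->; field.
under eq_bigr => j _ do rewrite posE.
rewrite -mulr_suml big_split/= sumrB sum_marginals simplex_sum1 V1 subrr addr0.
by congr (_ / _); apply: eq_bigr => j _; rewrite !mxE.
Qed.

End Rounding.

(** * Existence of an optimal plan *)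

Section OptimalPlan.
Variables (R : realType) (m n : nat) (C : tensor R m n) (p : 'M[R]_(m, n)).
Hypotheses (m_gt0 : (0 < m)%N) (p_simplex : forall k, in_simplex (row k p)).

Let N := #|{: multi_index m n}|.
(* Tensors are given the topology of row vectors by listing their entries. *)
Let plan (v : 'rV[R]_N) : tensor R m n := [ffun i => v ord0 (enum_rank i)].

Lemma continuous_plan_functional (c : multi_index m n -> R) :
  continuous (fun v : 'rV[R]_N => \sum_i c i * plan v i).
Proof.
elim: (index_enum _) => [|i s IH].
  rewrite (_ : (fun _ => _) = cst 0); first exact: cst_continuous.
  by apply/funext => v; rewrite big_nil.
rewrite (_ : (fun _ => _) = (fun v : 'rV[R]_N =>
    c i * v ord0 (enum_rank i) + \sum_(j <- s) c j * plan v j)).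
  move=> v; apply: cvgD (IH v); apply: cvgM; first exact: cvg_cst.
  exact: coord_continuous.
by apply/funext => v; rewrite big_cons ffunE.
Qed.

(** The product coupling is feasible, and the feasible tensors form a closed
    subset of the unit cube. *)
Lemma optimal_exists : exists X, optimal C p X.
Proof.
pose box := [set v : 'rV[R]_N | forall l, `[0, 1]%classic (v ord0 l)]%classic.
pose slices := (\bigcap_(kj in [set: 'I_m * 'I_n])
  ((fun v => marginals (plan v) kj.1 kj.2) @^-1` [set p kj.1 kj.2]))%classic.
have K_compact : compact (box `&` slices)%classic.
  apply: compact_closedI.
    exact: (@rV_compact R N (fun=> `[0, 1]%classic) (fun=> @segment_compact _ _ _)).
  apply: closed_bigI => -[k j] _ /=.
  apply: preimage_closed; last exact: closed_eq.
  move=> v _; rewrite (_ : (fun _ => _) =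
      fun v => \sum_(i : multi_index m n) (i k == j)%:R * plan v i).
    exact: continuous_plan_functional.
  apply/funext => w; rewrite marginalsE big_mkcond; apply: eq_bigr => i _.
  by case: ifP; rewrite ?mul1r ?mul0r.
pose vec (X : tensor R m n) : 'rV[R]_N := \row_l X (enum_val l).
have vecK X : plan (vec X) = X.
  by apply/ffunP => i; rewrite ffunE mxE enum_rankK.
have vec_K X : feasible p X -> (box `&` slices)%classic (vec X).
  move=> [X0 Xp]; split; last by move=> kj _ /=; rewrite vecK Xp.
  move=> l; rewrite /= in_itv/= mxE X0/=.
  pose k := Ordinal m_gt0.
  rewrite -(simplex_sum1 p_simplex k) -Xp sum_marginals (bigD1 (enum_val l))//=.
  by rewrite lerDl sumr_ge0.
have K_feasible v : (box `&` slices)%classic v -> feasible p (plan v).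
  move=> [v01 vp]; split.
    by move=> i; rewrite ffunE; have := v01 (enum_rank i); rewrite /= in_itv => /andP[].
  by apply/matrixP => k j; exact: (vp (k, j)).
have prod_feasible : feasible p (rank_one 1 p).
  split; last first.
    by apply: marginals_rank_one => // *; rewrite (simplex_ge0, simplex_sum1).
  move=> i; rewrite ffunE expr1n divr1 prodr_ge0// => k _; exact: simplex_ge0.
have [v /set_mem Kv v_min] := @compact_EVT_min _ _ (fun v => inner C (plan v)) _
  (ex_intro _ _ (vec_K _ prod_feasible)) K_compact
  (continuous_subspaceT (@continuous_plan_functional C)).
exists (plan v); split; first exact: K_feasible.
by move=> Y /vec_K/mem_set/v_min; rewrite vecK.
Qed.

End OptimalPlan.

(** * Accuracy and complexity of the method *)

Section Approximation.
Variables (R : realType) (m n : nat) (p : 'M[R]_(m, n)) (C : tensor R m n).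
Variable eps : R.
Hypotheses (m_gt0 : (0 < m)%N) (n_gt1 : (1 < n)%N).
Hypotheses (p_simplex : forall k, in_simplex (row k p)) (C_ge0 : nonneg C).
Hypotheses (eps_gt0 : 0 < eps) (eps_le : eps <= 32 * m%:R * normoo C).

Let M0 : 0 < m%:R :> R. Proof. by rewrite ltr0n. Qed.
Let N0 : 0 < n%:R :> R. Proof. by rewrite ltr0n ltnW. Qed.

Lemma normoo_gt0 : 0 < normoo C.
Proof. by have := lt_le_trans eps_gt0 eps_le; rewrite pmulr_rgt0// mulr_gt0. Qed.

Let W0 := normoo_gt0.
Let w := eps'_of C eps / (4 * m%:R).

Lemma smoothing_weightE : w * normoo C = eps / (32 * m%:R).
Proof. by rewrite /w /eps'_of; field; rewrite !gt_eqF. Qed.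

Lemma smoothing_weight_gt0 : 0 < w.
Proof. by rewrite -(pmulr_lgt0 _ W0) smoothing_weightE divr_gt0// mulr_gt0. Qed.

Lemma smoothing_weight_le1 : w <= 1.
Proof.
rewrite -(ler_pM2r W0) smoothing_weightE mul1r ler_pdivrMr ?mulr_gt0//.
by rewrite mulrC.
Qed.

Let w0 := smoothing_weight_gt0.
Let w1 := smoothing_weight_le1.

Lemma smoothedE k j : smoothed C p eps k j = (1 - w) * p k j + w / n%:R.
Proof. by rewrite !mxE mulr1. Qed.

Lemma smoothed_gt0 k j : 0 < smoothed C p eps k j.
Proof.
rewrite smoothedE; apply: ltr_wpDl; last exact: divr_gt0.
by apply: mulr_ge0; [rewrite subr_ge0 | exact: simplex_ge0].
Qed.

Lemma smoothed_sum1 k : \sum_j smoothed C p eps k j = 1.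
Proof.
under eq_bigr => j _ do rewrite smoothedE.
rewrite big_split /= -mulr_sumr simplex_sum1// sumr_const card_ord.
rewrite -(mulr_natr (w / n%:R)).
by rewrite divfK ?gt_eqF// mulr1 subrK.
Qed.

Lemma gamma_of_gt0 : 0 < gamma_of m n eps.
Proof. by rewrite divr_gt0// !mulr_gt0// ln_gt0// ltr1n. Qed.

Lemma smoothed_dist : \sum_k norm1 (row k (smoothed C p eps - p)) <= 2 * m%:R * w.
Proof.
have -> : 2 * m%:R * w = \sum_(k < m) 2 * w.
  by rewrite sumr_const card_ord -mulr_natl; ring.
apply: ler_sum => k _; rewrite norm1_row.
have -> : 2 * w = \sum_j (w * p k j + w / n%:R).
  rewrite big_split /= -mulr_sumr simplex_sum1// sumr_const card_ord.
  rewrite -(mulr_natr (w / n%:R)).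
  by rewrite divfK ?gt_eqF//; ring.
apply: ler_sum => j _; rewrite !mxE mulr1 -/w.
have p0 := simplex_ge0 p_simplex k j.
have a0 := mulr_ge0 (ltW w0) p0; have b0 : 0 < w / n%:R by rewrite divr_gt0.
by rewrite ler_norml; apply/andP; split; lra.
Qed.

(** Relative entropy with respect to the uniform tensor is nonnegative. *)
Lemma entropy_ge (X : tensor R m n) : nonneg X -> \sum_i X i = 1 ->
  - (m%:R * ln n%:R) <= \sum_i X i * ln (X i).
Proof.
move=> X0 X1; pose u : R := (n%:R ^+ m)^-1.
have u0 : 0 < u by rewrite invr_gt0 exprn_gt0.
have lnu : ln u = - (m%:R * ln n%:R).
  by rewrite lnV ?posrE ?exprn_gt0// lnXn// mulr_natl.
have : \sum_i (X i - u) <= \sum_i X i * (ln (X i) - ln u).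
  by apply: ler_sum => i _; exact: sub_le_mul_lnB.
rewrite sumrB X1 sumr_const card_multi_index -(mulr_natr u) natrX mulVf; last first.
  by rewrite gt_eqF ?exprn_gt0.
under [X in _ <= X]eq_bigr => i _ do rewrite mulrBr.
by rewrite sumrB -mulr_suml X1 mul1r lnu; lra.
Qed.

(** Smoothing of the marginals lifts to plans: mix with the uniform plan. *)
Lemma smoothed_plan X : feasible p X ->
  exists2 Y, nonneg Y /\ marginals Y = smoothed C p eps
    & inner C Y <= inner C X + eps / (32 * m%:R).
Proof.
move=> [X0 Xp].
pose u : 'M[R]_(m, n) := const_mx n%:R^-1.
have uE k j : u k j = n%:R^-1 by rewrite mxE.
have u_sum k : \sum_j u k j = 1.
  under eq_bigr => j _ do rewrite uE.
  by rewrite sumr_const card_ord -(mulr_natr n%:R^-1) mulVf ?gt_eqF.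
have u_ge0 k j : 0 <= u k j by rewrite uE invr_ge0 ltW.
have unif := marginals_rank_one u_ge0 u_sum.
have unif_ge0 : nonneg (rank_one 1 u).
  by move=> i; rewrite ffunE expr1n divr1 prodr_ge0.
exists ((1 - w) *: X + w *: rank_one 1 u).
  split.
    move=> i; rewrite add_tensorE !scale_tensorE addr_ge0// mulr_ge0 ?subr_ge0//.
    exact: ltW.
  rewrite marginalsD !marginalsZ unif Xp.
  by apply/matrixP => k j; rewrite smoothedE !mxE.
rewrite innerD !innerZ -smoothing_weightE.
have := inner_le_normoo C unif_ge0.
rewrite -(sum_marginals _ (Ordinal m_gt0)) unif u_sum mulr1 => /(ler_wpM2l (ltW w0)).
have := mulr_ge0 (ltW w0) (inner_ge0 C_ge0 X0); lra.
Qed.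

Lemma F_le_inner gamma (Y : tensor R m n) : 0 < gamma -> nonneg Y ->
  \sum_i Y i = 1 -> F C gamma Y <= inner C Y.
Proof.
move=> g0 Y0 Y1; rewrite /F gerDl pmulr_rle0//.
apply: sumr_le0 => i _; rewrite mulr_ge0_le0// ln_le0// -Y1 (bigD1 i)//=.
by rewrite lerDl sumr_ge0.
Qed.

(** With G = F(X) + phi(U) <= 0, weak duality gives
    F(X) <= <C, Xopt> + eps/32 + G, dropping the entropy from F costs eps/2, and
    rounding costs at most (eps/2 - G)/4 + eps/32 by the criterion and the
    distance of the smoothed marginals. The sum is below <C, Xopt> + eps. *)
Lemma approx_of_criterion (X : tensor R m n) U :
  nonneg X -> \sum_i X i = 1 ->
  F C (gamma_of m n eps) X + phi C (gamma_of m n eps) (smoothed C p eps) U <= 0 ->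
  2 * normoo C * \sum_k norm1 (row k (marginals X - smoothed C p eps))
    + F C (gamma_of m n eps) X + phi C (gamma_of m n eps) (smoothed C p eps) U
  <= eps / 2 ->
  approx_solution C p eps (rounding p X).
Proof.
move=> X0 X1 gap crit; split; first exact: rounding_feasible.
have [Xopt opt] := optimal_exists C m_gt0 p_simplex.
exists Xopt => //; have [feas _] := opt.
have [Y [Y0 Yq] Ycost] := smoothed_plan feas.
have g0 : 0 < gamma_of m n eps by exact: gamma_of_gt0.
have Y1 : \sum_i Y i = 1.
  by rewrite -(sum_marginals _ (Ordinal m_gt0)) Yq smoothed_sum1.
have weak := weak_duality C (ltnW n_gt1) g0 U Y0 Y1 Yq.
have FY := F_le_inner g0 Y0 Y1.
have FX : inner C X <= F C (gamma_of m n eps) X + eps / 2.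
  have := ler_wpM2l (ltW g0) (entropy_ge X0 X1).
  have -> : gamma_of m n eps * - (m%:R * ln n%:R) = - (eps / 2).
    by rewrite /gamma_of; field; rewrite !gt_eqF// ln_gt0// ltr1n.
  by rewrite /F; lra.
have := rounding_cost m_gt0 p_simplex C_ge0 X0 X1.
have : normoo C * \sum_k norm1 (row k (marginals X - p)) <=
    normoo C * \sum_k norm1 (row k (marginals X - smoothed C p eps)) + eps / 16.
  have -> : eps / 16 = normoo C * (2 * m%:R * w).
    have -> : normoo C * (2 * m%:R * w) = 2 * m%:R * (w * normoo C) by ring.
    by rewrite smoothing_weightE; field; rewrite gt_eqF.
  rewrite -mulrDr ler_wpM2l ?(ltW W0)//.
  apply: le_trans (lerD (lexx _) smoothed_dist).
  rewrite -big_split; apply: ler_sum => k _; rewrite !norm1_row -big_split.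
  apply: ler_sum => j _ /=.
  apply: le_trans (ler_normD _ _).
  by rewrite !mxE le_eqVlt; apply/orP; left; apply/eqP; congr `|_|; ring.
have : eps / (32 * m%:R) <= eps / 32.
  rewrite ler_wpM2l ?(ltW eps_gt0)// lef_pV2 ?posrE ?mulr_gt0//.
  by rewrite ler_peMr// ler1n.
have := eps_gt0; lra.
Qed.

Lemma log_factor_ge : 1 <= log_factor C eps /\ ln n%:R <= log_factor C eps.
Proof.
have lnm : 0 <= ln m%:R :> R by rewrite ln_ge0// ler1n.
have lnn : 0 <= ln n%:R :> R by rewrite ln_ge0// ler1n ltnW.
have := normr_ge0 (ln (normoo C / eps)); rewrite /log_factor; split; lra.
Qed.

(** Dividing the bound of [pdaam_exec_length] by gamma eps gives
    t^2 <= 64 m^3 n ln n W^2 / eps^2; the additional last step is absorbed by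
    the main term because eps <= 32 m W. *)
Lemma iterations_le t N s : amot_exec C p eps t N s ->
  t%:R <= 40 * (m%:R ^+ 2 * Num.sqrt n%:R * normoo C / eps) * log_factor C eps.
Proof.
have [L1 Ln] := log_factor_ge; set L := log_factor C eps in L1 Ln *.
set W := normoo C; set r := Num.sqrt n%:R.
have L0 : 0 < L by exact: lt_le_trans L1.
have r1 : 1 <= r by rewrite -(sqrtr1 R) ler_sqrt// ler1n ltnW.
have rE : r ^+ 2 = n%:R by rewrite sqr_sqrtr// ltW.
have M1 : 1 <= m%:R :> R by rewrite ler1n.
set b := m%:R ^+ 2 * r * W * L.
have -> : 40 * (m%:R ^+ 2 * r * W / eps) * L = 40 * b / eps by rewrite /b; ring.
have b0 : 0 < b by rewrite !mulr_gt0 ?exprn_gt0 ?(lt_le_trans _ r1).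
rewrite ler_pdivlMr//; case: t => [_|t exec].
  by rewrite mul0r mulr_ge0// ltW.
have eps_b : eps <= 32 * b.
  apply: le_trans eps_le _; rewrite -/W -mulrA ler_wpM2l//.
  have rL : 1 <= m%:R * r * L.
    by rewrite -[X in X <= _]mulr1 ler_pM// -[X in X <= _]mulr1 ler_pM.
  have := ler_wpM2l (mulr_ge0 (ltW M0) (ltW W0)) rL.
  by rewrite mulr1 /b -/W => /le_trans; apply; lra.
have := pdaam_exec_length m_gt0 (ltnW n_gt1) gamma_of_gt0 smoothed_gt0
  smoothed_sum1 eps_gt0 exec.
rewrite -/W -rE => len.
have ln0 : 0 < ln n%:R :> R by rewrite ln_gt0// ltr1n.
have tb : (eps * t%:R) ^+ 2 <= (8 * b) ^+ 2.
  have -> : (eps * t%:R) ^+ 2 = 2 * m%:R * ln n%:R *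
      (gamma_of m n eps * eps * t%:R ^+ 2).
    by rewrite /gamma_of; field; rewrite !gt_eqF.
  apply: (@le_trans _ _ (2 * m%:R * ln n%:R * (32 * W ^+ 2 * m%:R ^+ 2 * r ^+ 2))).
    by rewrite ler_wpM2l// !mulr_ge0// ltW.
  have -> : 2 * m%:R * ln n%:R * (32 * W ^+ 2 * m%:R ^+ 2 * r ^+ 2) =
      64 * W ^+ 2 * m%:R ^+ 2 * r ^+ 2 * (m%:R * ln n%:R) by ring.
  have -> : (8 * b) ^+ 2 = 64 * W ^+ 2 * m%:R ^+ 2 * r ^+ 2 * (m%:R ^+ 2 * L ^+ 2).
    by rewrite /b; ring.
  rewrite ler_wpM2l ?mulr_ge0 ?exprn_ge0 ?sqrtr_ge0 ?(ltW W0)//.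
  rewrite ler_pM ?(ltW ln0)//; first by rewrite ler_eXnr.
  by apply: le_trans Ln _; rewrite ler_eXnr.
have : eps * t%:R <= 8 * b.
  by move: tb; rewrite ler_pXn2r// nnegrE mulr_ge0// ltW.
rewrite -natr1 mulrDl mul1r; lra.
Qed.

End Approximation.

(** * The complexity bound *)

Theorem theorem8 (R : realType) :
  exists (K : R) (q : nat),
  forall (m n : nat) (p : 'M[R]_(m, n)) (C : tensor R m n) (eps : R),
    (2 <= m)%N -> (2 <= n)%N ->
    (forall k, in_simplex (row k p)) ->
    nonneg C ->
    (* eps small: the smoothing weight eps' / (4 m) is at most 1 *)
    0 < eps -> eps <= 32 * m%:R * normoo C ->
    [/\ (* the algorithm never gets stuck before the stopping criterion holds *)
        forall t N s, amot_exec C p eps t N s -> ~ amot_halted C p eps t s ->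
          exists c s', amot_step C p eps s c s',
        (* it terminates within the claimed number of operations *)
        exists T : nat, forall t N s, amot_exec C p eps t N s -> (t <= T)%N,
        forall t N s, amot_exec C p eps t N s ->
          N%:R <= K * (m%:R ^+ 3 * n%:R `^ (m%:R + 2^-1) * normoo C / eps)
                    * log_factor C eps ^+ q
      & (* and its output is an eps-approximate solution *)
        forall t N s, amot_exec C p eps t N s -> amot_halted C p eps t s ->
          approx_solution C p eps (amot_output p s) ].
Proof.
(* 160 = 40 * 4: [iterations_le], and 2 m + 3 <= 4 m. *)
exists 160, 1%N => m n p C eps m_ge2 n_ge2 p_simplex C_ge0 eps_gt0 eps_le.
have m_gt0 : (0 < m)%N by exact: ltnW.
have n_gt0 : (0 < n)%N by exact: ltnW.
have gamma_gt0 := gamma_of_gt0 m_gt0 n_ge2 eps_gt0.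
have p_gt0 := smoothed_gt0 m_gt0 n_ge2 p_simplex eps_gt0 eps_le.
have p_sum1 := smoothed_sum1 C eps n_ge2 p_simplex.
split.
- move=> t N s exec not_halted.
  have acc := pdaam_exec_not_halted m_gt0 n_gt0 gamma_gt0 p_gt0 p_sum1 eps_gt0
    exec not_halted.
  by have := pdaam_step_exists m_gt0 n_gt0 gamma_gt0 p_gt0 p_sum1 acc.
- pose T := 40 * (m%:R ^+ 2 * Num.sqrt n%:R * normoo C / eps) * log_factor C eps.
  exists (Num.truncn T) => t N s.
  move=> /(iterations_le m_gt0 n_ge2 p_simplex eps_gt0 eps_le) tT.
  by rewrite truncn_ge_nat// (le_trans _ tT).
- move=> t N s exec.
  have tT := iterations_le m_gt0 n_ge2 p_simplex eps_gt0 eps_le exec.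
  rewrite (pdaam_exec_cost exec) natrM expr1.
  have -> : n%:R `^ (m%:R + 2^-1) = n%:R ^+ m * Num.sqrt n%:R :> R.
    rewrite powRD; last by rewrite pnatr_eq0 -lt0n n_gt0 implybT.
    by rewrite powR_mulrn// powR12_sqrt.
  have cost : ((2 * m + 3) * n ^ m)%N%:R <= 4 * m%:R * n%:R ^+ m :> R.
    by rewrite -natrX -!natrM ler_nat leq_mul2r; apply/orP; right; lia.
  have := ler_pM (ler0n _ _) (ler0n _ _) tT cost => /le_trans; apply.
  by rewrite le_eqVlt; apply/orP; left; apply/eqP; ring.
- move=> t N s exec [t_gt0 crit].
  have [X_ge0 X_sum1 gap] := pdaam_exec_X m_gt0 n_gt0 gamma_gt0 p_gt0 p_sum1
    eps_gt0 t_gt0 exec.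
  exact: approx_of_criterion gap crit.
Qed.
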